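(* Any noninterlaced minor of a symmetric $n\times n$ matrix $M$ is a positive rational function of the small central minors $\mathrm{CM}_{x,y}(M)$ of $M$ for which $1\le x\le n$.
   Context: Indices $1,\dots,n$ of the rows and columns of an $n\times n$ matrix are regarded as arranged in cyclic order, and interpreted modulo $n$. Subsets $A,B\subset\{1,\dots,n\}$ are noninterlaced if they are contained in disjoint intervals of the cyclic order. A noninterlaced minor is $\det M_A^B=\det\big(M_{a_s,b_t}\big)_{s,t=1}^k$ for noninterlaced $A,B$ of the same cardinality $k$, with rows and columns ordered so that $a_1,\dots,a_k,b_k,\dots,b_1$ are in cyclic order, where $A=\{a_1,\dots,a_k\}$, $B=\{b_1,\dots,b_k\}$. The contiguous minor is $$\mathrm{CM}_{a,b,y}(M)=\det M_{a,a+1,\dots,a+y-1}^{\,b+y-1,\dots,b+1,b},$$ the determinant of the $y\times y$ submatrix with rows $a,a+1,\dots,a+y-1$ (in this order) and columns $b+y-1,\dots,b+1,b$ (in this order), indices modulo $n$. The central minor $\mathrm{CM}_{x,y}(M)$ ($x$ modulo $2n$, $0\le y\le n$) is $\mathrm{CM}_{a,b,y}(M)$ with $$a=\left\lfloor\frac{x-y}{2}\right\rfloor,\qquad b=\left\lfloor\frac{x-y+n-((n-1)\bmod 2)}{2}\right\rfloor .$$ The small central minors with $1\le x\le n$ are the $\mathrm{CM}_{x,y}(M)$ with $1\le x\le n$ and either $1\le y<n/2$, or $y=n/2$ and $x+y$ odd (there are $\binom n2$ of them). A positive rational function is a quotient of two nonzero polynomials with nonnegative coefficients. The statement concerns generic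 symmetric matrices: it is an identity of rational functions in the entries $M_{i,j}=M_{j,i}$ regarded as indeterminates (in particular it is valid whenever all these small central minors are positive). *)

(* Defs.v *)
From mathcomp Require Import all_boot all_order all_algebra.
From mathcomp Require Import fraction.
From mathcomp.multinomials Require Import mpoly.

Set Implicit Arguments.
Unset Strict Implicit.
Unset Printing Implicit Defensive.

Import Order.TTheory GRing.Theory Num.Theory.
Local Open Scope ring_scope.

Lemma cyc_idx_subproof (n : nat) (n_gt0 : (0 < n)%N) (z : int) :
  (absz (z %% n%:Z)%Z < n)%N.
Proof.
have nz : n%:Z != 0 by rewrite eqz_nat -lt0n.
by rewrite -ltz_nat gez0_abs ?modz_ge0 // ltz_pmod.
Qed.

(* Row and column indices are residues modulo n: the ordinal i stands for the
   class of i, so the index usually written n is the ordinal 0. *)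
Definition cyc_idx (n : nat) (n_gt0 : (0 < n)%N) (z : int) : 'I_n :=
  Ordinal (cyc_idx_subproof n_gt0 z).

(* {c, c+1, ..., c+l-1} modulo n *)
Definition cyc_interval (n : nat) (n_gt0 : (0 < n)%N) (c : int) (l : nat) :
    {set 'I_n} :=
  [set cyc_idx n_gt0 (c + (s : nat)%:Z) | s : 'I_l].

Definition noninterlaced (n : nat) (n_gt0 : (0 < n)%N) (A B : {set 'I_n}) :
    Prop :=
  exists (c d : int) (l m : nat),
    [/\ A \subset cyc_interval n_gt0 c l,
        B \subset cyc_interval n_gt0 d m
      & [disjoint cyc_interval n_gt0 c l & cyc_interval n_gt0 d m]].

(* The (distinct) entries of s are met in this order when going once around
   the circle: some rotation of s is strictly increasing. *)
Definition in_cyclic_order (n : nat) (s : seq 'I_n) : Prop :=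
  exists r : nat, sorted (fun i j : 'I_n => (i < j)%N) (rot r s).

(* The submatrix has rows a, a+1, ..., a+y-1 and columns b+y-1, ..., b+1, b,
   each in the order listed. *)
Definition contiguous_minor (R : comNzRingType) (n : nat) (n_gt0 : (0 < n)%N)
    (M : 'M[R]_n) (a b : int) (y : nat) : R :=
  \det (\matrix_(s < y, t < y)
          M (cyc_idx n_gt0 (a + (s : nat)%:Z))
            (cyc_idx n_gt0 (b + y%:Z - 1 - (t : nat)%:Z))).

(* Euclidean division of integers by 2 is the floor. *)
Definition central_minor (R : comNzRingType) (n : nat) (n_gt0 : (0 < n)%N)
    (M : 'M[R]_n) (x : int) (y : nat) : R :=
  contiguous_minor n_gt0 M
    ((x - y%:Z) %/ 2)%Z
    ((x - y%:Z + n%:Z - ((n.-1 %% 2)%N)%:Z) %/ 2)%Z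
    y.

(* The pairs (x, y) of the small central minors with 1 <= x <= n. *)
Definition small_idx (n : nat) : finType :=
  {p : 'I_n.+1 * 'I_n.+1 |
    (0 < p.1)%N && (0 < p.2)%N &&
    ((p.2 * 2 < n)%N || ((p.2 * 2 == n)%N && odd (p.1 + p.2)))}.

Definition small_central_minors (R : comNzRingType) (n : nat)
    (n_gt0 : (0 < n)%N) (M : 'M[R]_n) : #|small_idx n|.-tuple R :=
  [tuple central_minor n_gt0 M
           ((val (enum_val i)).1 : nat)%:Z ((val (enum_val i)).2 : nat)
     | i < #|small_idx n|].

Definition sym_idx (n : nat) : finType :=
  {p : 'I_n * 'I_n | (p.1 <= p.2)%N}.

Definition sort_pair (n : nat) (i j : 'I_n) : 'I_n * 'I_n :=
  if (i <= j)%N then (i, j) else (j, i).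

Lemma sort_pairP (n : nat) (i j : 'I_n) :
  ((sort_pair i j).1 <= (sort_pair i j).2)%N.
Proof. by rewrite /sort_pair; case: (leqP i j) => // /ltnW. Qed.

Definition sym_pair (n : nat) (i j : 'I_n) : sym_idx n :=
  exist _ (sort_pair i j) (sort_pairP i j).

(* One indeterminate for each pair i <= j. *)
Definition generic_sym (R : comNzRingType) (n : nat) :
    'M[{mpoly R[#|sym_idx n|]}]_n :=
  \matrix_(i, j) 'X_(enum_rank (sym_pair i j)).

Lemma tr_generic_sym (R : comNzRingType) (n : nat) :
  (generic_sym R n)^T = generic_sym R n.
Proof.
apply/matrixP=> i j; rewrite !mxE; congr 'X_(enum_rank _); apply: val_inj.
rewrite /= /sort_pair; case: (ltngtP i j) => // /val_inj ->.
by [].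
Qed.

Definition nonneg_coefs (R : realDomainType) (N : nat) (p : {mpoly R[N]}) :
    Prop :=
  forall m : 'X_{1..N}, 0 <= p@_m.

(* f, an element of the fraction field of R[X_1, ..., X_l], is the value
   at u of a positive rational function in N variables. *)
Definition positive_ratfun_of (R : realDomainType) (N l : nat)
    (u : N.-tuple {mpoly R[l]}) (f : {fraction {mpoly R[l]}}) : Prop :=
  exists P Q : {mpoly R[N]},
    [/\ P != 0 /\ nonneg_coefs P,
        Q != 0 /\ nonneg_coefs Q,
        comp_mpoly u Q != 0
      & f = tofrac (comp_mpoly u P) / tofrac (comp_mpoly u Q)].

(* Main.v *)
Require Import Defs.
From mathcomp Require Import all_boot all_order all_algebra perm.
From mathcomp Require Import fraction zify ring.
From mathcomp.multinomials Require Import mpoly.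

Set Implicit Arguments.
Unset Strict Implicit.
Unset Printing Implicit Defensive.

Import Order.TTheory GRing.Theory Num.Theory.
Local Open Scope ring_scope.

(** Why the theorem holds.  The minors in question satisfy relations of the form
   [X * Y = Z1 * W1 + Z2 * W2] between minors of the same kind, so [X] is
   obtained from the others without subtraction as soon as [Y <> 0]; and [Y] is
   never zero, since no indeterminate occurs twice in a noninterlaced minor of
   the generic symmetric matrix ([generic_minor_neq0]).  Values of positive
   rational functions are closed under sums, products and nonzero quotients
   ([positive_ratfun_sf]), so it remains to reach every noninterlaced minor from
   the small central ones by such relations.

   Unroll the circle of indices and reverse the columns: put
   [N i j = M i (-j)] with [i] and [j] ranging over the integers.  A cyclically
   ordered list lifts to increasing integers ([unroll_cyclic]), so a
   noninterlaced minor becomes a minor of [N] with increasing rows and columns,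
   all of whose entries lie in the strip [-n < i + j < 0].  The symmetry and the
   periodicity of [M] make [N] invariant under [(i, j) -> (-j, -i)] and under
   translations by [n] in either coordinate.

   Contiguous minors.  Write [S a c y] for the order-[y] minor of [N] with rows
   [a, a + 1, ...] and columns [c, c + 1, ...]; it is centred on the antidiagonal
   of index [a + c + y - 1].  Dodgson condensation ([solid_dodgson]) gives
     [S a c y * S (a+1) (c+1) y
      = S a c (y+1) * S (a+1) (c+1) (y-1) + S a (c+1) y * S (a+1) c y],
   where the two factors on the left are centred on the antidiagonals just
   below and just above the one of the four minors on the right.  Central minors
   fill two consecutive antidiagonals in the middle of the strip, hence they
   determine the whole upper half, and the lower half by reflection
   ([pos_solid]).  That labels [x] from [1] to [n] are enough is again due to the
   reflection.  It identifies the central minors labelled [x] and [x + n]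
   ([pos_central_reflect]), except when [n] and [x + y] are even; in that case the
   relation above, taken on the axis of the reflection, has the product of these
   two minors on its left ([pos_central_even]).

   Other minors.  A minor with nonconsecutive rows is reached from those with
   consecutive rows by a three-term Pluecker relation ([three_term],
   [fill_rows]), and columns are treated by transposition ([fill_minors]).  This
   never leaves the rectangle spanned by the extreme rows and columns, hence
   never leaves the strip.

   Both determinantal identities come from the Schur complement
   ([minor_schur]). *)

(** * Minors of a two-way infinite array *)

(** Rows and columns are listed, so that the order in which they are read,
   hence the sign of the determinant, is part of the data. *)
Definition minor (F : comNzRingType) (N : int -> int -> F) (k : nat)
    (s t : seq int) : F :=
  \det (\matrix_(i < k, j < k) N (nth 0 s i) (nth 0 t j)).

Section MinorBasics.
Variable F : comNzRingType.
Implicit Types (N : int -> int -> F) (s t : seq int).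

Lemma minor0 N s t : minor N 0 s t = 1.
Proof. exact: det_mx00. Qed.

Lemma minor1 N x y : minor N 1 [:: x] [:: y] = N x y.
Proof. by rewrite /minor det_mx11 mxE. Qed.

Lemma minor2 N x1 x2 y1 y2 :
  minor N 2 [:: x1; x2] [:: y1; y2] = N x1 y1 * N x2 y2 - N x1 y2 * N x2 y1.
Proof.
rewrite /minor (expand_det_row _ 0) !big_ord_recl big_ord0 /cofactor !det_mx11.
by rewrite !mxE /= !mulN1r !mul1r addr0 mulrN.
Qed.

Lemma minor_tr N k s t : minor N k s t = minor (fun i j => N j i) k t s.
Proof.
by rewrite /minor -det_tr; congr (\det _); apply/matrixP=> i j; rewrite !mxE.
Qed.

Lemma eq_minor N N' k s t s' t' :
    (forall i j, (i < k)%N -> (j < k)%N ->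
      N (nth 0 s i) (nth 0 t j) = N' (nth 0 s' i) (nth 0 t' j)) ->
  minor N k s t = minor N' k s' t'.
Proof. by move=> eqN; congr (\det _); apply/matrixP=> i j; rewrite !mxE eqN. Qed.

Lemma minor_swap N k s1 s2 x y t : ((size s1).+1 < k)%N ->
  minor N k (s1 ++ [:: x, y & s2]) t = - minor N k (s1 ++ [:: y, x & s2]) t.
Proof.
move=> ltk; have ltk' := ltnW ltk.
rewrite /minor; set A := (X in - \det X).
pose p := Ordinal ltk'; pose q := Ordinal ltk.
have neq : p != q by rewrite -val_eqE /= neq_ltn ltnSn.
suff -> : \matrix_(i, j) N (nth 0 (s1 ++ [:: x, y & s2]) (i : 'I_k))
                           (nth 0 t (j : 'I_k)) = xrow p q A.
  by rewrite /xrow row_permE det_mulmx det_perm odd_tperm neq expr1 mulN1r.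
apply/matrixP=> i j; rewrite !mxE !nth_cat; congr (N _ _).
case: tpermP => [->|->|/eqP nip /eqP niq] /=.
- by rewrite ltnn subnn ltnNge leqnSn /= subSnn.
- by rewrite ltnn subnn ltnNge leqnSn /= subSnn.
- case: ltnP => // lei; move: nip niq; rewrite -!val_eqE /= => nip niq.
  have [m ->] : exists m, (i - size s1 = m.+2)%N by exists (i - size s1 - 2)%N; lia.
  by [].
Qed.

Lemma minor_move N k s1 x s2 s3 t : (size s1 + size s2 < k)%N ->
  minor N k (s1 ++ x :: s2 ++ s3) t
    = (-1) ^+ size s2 * minor N k (s1 ++ s2 ++ x :: s3) t.
Proof.
elim: s2 s1 => [|y s2 IH] s1 /= ltk; first by rewrite mul1r.
rewrite minor_swap; last by lia.
have := IH (rcons s1 y); rewrite size_rcons !cat_rcons => ->; last by lia.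
by rewrite exprS mulN1r mulNr.
Qed.

End MinorBasics.

(** Schur complement: Gaussian elimination of the rows [s] by means of the
   columns [t] turns every larger minor into a minor of the reduced array.
   All the determinantal identities below are identities between minors of
   order at most two of the reduced array. *)
Lemma minor_schur (F : fieldType) (N : int -> int -> F) k (s t : seq int) :
    size s = k -> size t = k -> minor N k s t != 0 ->
  exists S : int -> int -> F, forall m s' t',
    minor N (k + m) (s ++ s') (t ++ t') = minor N k s t * minor S m s' t'.
Proof.
move=> ss st nz.
pose P := \matrix_(i < k, j < k) N (nth 0 s i) (nth 0 t j).
pose r x := \row_(j < k) N x (nth 0 t j).
pose c y := \col_(i < k) N (nth 0 s i) y.
exists (fun x y => N x y - (r x *m invmx P *m c y) 0 0) => m s' t'.
have uP : P \in unitmx by rewrite unitmxE unitfE.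
pose U := \matrix_(i < k, j < m) N (nth 0 s i) (nth 0 t' j).
pose V := \matrix_(i < m, j < k) N (nth 0 s' i) (nth 0 t j).
pose W := \matrix_(i < m, j < m) N (nth 0 s' i) (nth 0 t' j).
rewrite {1}/minor.
have -> : \matrix_(i, j) N (nth 0 (s ++ s') (i : 'I_(k + m)))
                           (nth 0 (t ++ t') (j : 'I_(k + m)))
    = block_mx P U V W.
  apply/matrixP=> i j; rewrite !mxE !nth_cat ss st.
  case: (splitP i) => i' ->; rewrite !mxE;
    case: (splitP j) => j' ->; rewrite !mxE;
    by rewrite ?ltn_ord ?[(k + _ < k)%N]ltnNge ?leq_addr /= ?addKn.
have -> : block_mx P U V W =
    block_mx 1%:M 0 (V *m invmx P) 1%:M *m block_mx P U 0 (W - V *m invmx P *m U).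
  by rewrite mulmx_block !mul1mx !mul0mx !addr0 mulmxKV // addrC subrK.
rewrite det_mulmx det_lblock det_ublock !det1 !mul1r; congr (_ * \det _).
apply/matrixP=> i j; rewrite !mxE; congr (_ - _).
apply: eq_bigr => l _; rewrite !mxE; congr (_ * _).
by apply: eq_bigr => l' _; rewrite !mxE.
Qed.

Section MinorIdentities.
Variables (F : fieldType) (N : int -> int -> F).

(** Desnanot-Jacobi identity, also known as Dodgson condensation. *)
Lemma dodgson k x s y u t v : size s = k -> size t = k -> minor N k s t != 0 ->
  minor N k.+2 (x :: rcons s y) (u :: rcons t v) * minor N k s t
    + minor N k.+1 (x :: s) (rcons t v) * minor N k.+1 (rcons s y) (u :: t)
  = minor N k.+1 (x :: s) (u :: t) * minor N k.+1 (rcons s y) (rcons t v).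
Proof.
move=> ss st nz; have [S schur] := minor_schur ss st nz.
have mvr m r t' : (k < m)%N -> minor N m (x :: s ++ r) t' =
    (-1) ^+ k * minor N m (s ++ x :: r) t'.
  by move=> ltk; have := @minor_move _ N m [::] x s r t'; rewrite /= ss => ->.
have mvc m s' r : (k < m)%N -> minor N m s' (u :: t ++ r) =
    (-1) ^+ k * minor N m s' (t ++ u :: r).
  move=> ltk; rewrite !(minor_tr N).
  have := @minor_move _ (fun i j => N j i) m [::] u t r s'.
  by rewrite /= st => ->.
have sq : (-1) ^+ k * (-1) ^+ k = 1 :> F by rewrite -expr2 sqrr_sign.
have mvr1 t' := mvr k.+1 [::] t' (ltnSn k).
have mvc1 s' := mvc k.+1 s' [::] (ltnSn k).
rewrite !cats0 in mvr1 mvc1.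
rewrite -!cats1 !mvr1 !mvr ?mvc1 ?mvc ?ltnS ?leqnSn //.
rewrite -[k.+2]addn2 -[k.+1]addn1 !schur !minor1 !minor2.
set e := (-1) ^+ k in sq *.
by ring: sq.
Qed.

(** The three-term Pluecker relation, in the form that links minors of orders
   [k + 2] and [k + 1].  In the reduced array it says that a linear dependence
   between the rows [x], [y], [z] of a matrix with columns [u], [v] has their
   minors of order two as coefficients.  Listing [y] between [x] and [z], in the
   place where it belongs when the rows increase, is what makes all the signs
   positive. *)
Lemma three_term k x s1 y s2 z t u v :
    size (s1 ++ s2) = k -> size t = k -> minor N k (s1 ++ s2) t != 0 ->
  minor N k.+2 (x :: s1 ++ rcons s2 z) (rcons (rcons t u) v)
      * minor N k.+1 (s1 ++ y :: s2) (rcons t u)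
  = minor N k.+2 (x :: s1 ++ y :: s2) (rcons (rcons t u) v)
      * minor N k.+1 (s1 ++ rcons s2 z) (rcons t u)
    + minor N k.+2 (s1 ++ y :: rcons s2 z) (rcons (rcons t u) v)
      * minor N k.+1 (x :: s1 ++ s2) (rcons t u).
Proof.
move=> ss st nz; have [S schur] := minor_schur ss st nz.
have mvx m r t' : (k < m)%N -> minor N m (x :: (s1 ++ s2) ++ r) t' =
    (-1) ^+ k * minor N m ((s1 ++ s2) ++ x :: r) t'.
  by move=> ltk; have := @minor_move _ N m [::] x (s1 ++ s2) r t'; rewrite /= ss => ->.
have mvy m r t' : (k < m)%N -> minor N m (s1 ++ y :: s2 ++ r) t' =
    (-1) ^+ size s2 * minor N m ((s1 ++ s2) ++ y :: r) t'.
  by move=> ltk; rewrite minor_move -?size_cat ?ss // catA.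
have mvxy t' : minor N k.+2 (x :: s1 ++ y :: s2) t' =
    (-1) ^+ size s2 * ((-1) ^+ k * minor N k.+2 ((s1 ++ s2) ++ [:: x; y]) t').
  rewrite -(mvx _ [:: y]) //.
  have := @minor_move _ N k.+2 (x :: s1) y s2 [::] t'; rewrite cats0 /= => ->.
    by rewrite catA.
  by rewrite -ss size_cat; lia.
have mvx1 t' := mvx k.+1 [::] t' (ltnSn k).
have mvy1 t' := mvy k.+1 [::] t' (ltnSn k).
rewrite !cats0 in mvx1 mvy1.
rewrite mvxy mvx1 mvy1 -!cats1 -!catA /= [s1 ++ s2 ++ [:: z]]catA mvx //.
rewrite [minor N k.+2 (s1 ++ y :: s2 ++ [:: z]) _]mvy // -?catA.
rewrite ![s1 ++ s2 ++ _]catA -[k.+2]addn2 -[k.+1]addn1 !schur !minor1 !minor2.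
by ring.
Qed.

End MinorIdentities.

(** * From contiguous minors to all minors *)

(** Division is allowed whenever the denominator is nonzero: membership in [pos]
   does not imply that an element is nonzero, as a positive polynomial can vanish
   at a point. *)
Definition subtraction_free (F : fieldType) (pos : F -> Prop) : Prop :=
  [/\ pos 1, forall x y, pos x -> pos y -> pos (x + y),
      forall x y, pos x -> pos y -> pos (x * y)
    & forall x y, pos x -> pos y -> y != 0 -> pos (x / y)].

Lemma subtraction_free_solve (F : fieldType) (pos : F -> Prop) x y z :
    subtraction_free pos -> x * y = z -> pos z -> pos y -> y != 0 -> pos x.
Proof.
by case=> _ _ _ posV <- pxy py y0; have := posV _ _ pxy py y0; rewrite mulfK.
Qed.

Definition run (a : int) (k : nat) : seq int := mkseq (fun m => a + m%:Z) k.

Lemma size_run a k : size (run a k) = k.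
Proof. exact: size_mkseq. Qed.

Lemma run_rcons a k : run a k.+1 = rcons (run a k) (a + k%:Z).
Proof. exact: mkseqS. Qed.

Lemma run_cons a k : run a k.+1 = a :: run (a + 1) k.
Proof.
rewrite /run /mkseq /= addr0 -[1%N]/(1 + 0)%N iotaDl -map_comp; congr (_ :: _).
by apply: eq_map => m /=; lia.
Qed.

Lemma mem_run a k x : (x \in run a k) = (a <= x < a + k%:Z).
Proof.
elim: k => [|k IH] in a *; first by rewrite in_nil; lia.
by rewrite run_cons inE IH; lia.
Qed.

Lemma sorted_run a k : sorted <%R (run a k).
Proof.
case: k => [//|k]; elim: k => [//|k IH] in a *.
by rewrite run_cons; have := IH (a + 1); rewrite run_cons /= => ->; rewrite ltrDl.
Qed.

Lemma run_or_gap (x : int) (s : seq int) : sorted <%R (x :: s) ->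
  x :: s = run x (size s).+1 \/
  exists (s1 : seq int) (y : int) (s2 : seq int),
    [/\ s = s1 ++ s2, s2 != [::] & sorted <%R (x :: s1 ++ y :: s2)].
Proof.
elim: s x => [|z s IH] x; first by left; rewrite run_cons.
rewrite /= => /andP[ltxz srt].
have [eqz | neqz] := eqVneq z (x + 1).
  case: (IH z srt) => [eqs | [s1 [y [s2 [-> s2n srt']]]]].
    by left; rewrite run_cons -eqz -eqs.
  by right; exists (z :: s1), y, s2; split => //=; rewrite ltxz.
right; exists [::], (x + 1), (z :: s); split => //=.
by rewrite srt andbT; apply/andP; split; lia.
Qed.

Definition within (lo hi : int) (s : seq int) : bool := all (fun x => lo <= x <= hi) s.

(** If the minors with consecutive rows are known, the others follow by
   induction on their order, then on the length of an interval that contains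
   their rows: a row [y] missing between the first row [x] and the last one [z]
   enters the three-term relation, which expresses the minor through minors
   that avoid [x] or [z] and through smaller ones.  The smaller ones omit the
   last column, so the class [cols] of column lists only has to be closed under
   that operation. *)
Lemma fill_rows (F : fieldType) (pos : F -> Prop) (N : int -> int -> F)
    (cols : seq int -> Prop) (lo hi : int) :
    subtraction_free pos ->
    (forall t v, cols (rcons t v) -> cols t) ->
    (forall k (s t : seq int), size s = k -> size t = k ->
       sorted <%R s -> within lo hi s -> cols t -> minor N k s t != 0) ->
    (forall k a t, size t = k -> within lo hi (run a k) -> cols t ->
       pos (minor N k (run a k) t)) ->
  forall k (s t : seq int), size s = k -> size t = k ->
    sorted <%R s -> within lo hi s -> cols t -> pos (minor N k s t).
Proof.
move=> sf colsP nz posrun k.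
have [_ posD posM _] := sf.
suff IH m (lo' hi' : int) (s t : seq int) :
    hi' - lo' < m%:Z -> lo <= lo' -> hi' <= hi ->
    size s = k -> size t = k -> sorted <%R s -> within lo' hi' s ->
    cols t -> pos (minor N k s t).
  by move=> s t; apply: (IH `|hi - lo|.+1); lia.
elim: k m lo' hi' s t => [|k IHk] m.
  by move=> lo' hi' [] // t _ _ _ _ st _ _; exact: (posrun 0%N 0).
elim: m => [|m IHm] lo' hi' [//|x s] t lt_m le_lo le_hi /= [ss] st srt.
  by case/andP=> /andP[? ?] _; lia.
move=> wi ct.
have wiW (a b : int) r : lo <= a -> b <= hi -> within a b r -> within lo hi r.
  by move=> ? ? /allP wr; apply/allP=> w /wr; lia.
case: (run_or_gap srt) => [eqs | [s1 [y [s2' [eqs s2n srty]]]]].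
  rewrite eqs ss; apply: (posrun k.+1) => //; rewrite -ss -eqs.
  exact: (wiW _ _ (x :: s) le_lo le_hi wi).
case/lastP: s2' s2n eqs srty => // s2 z _ eqs srty.
rewrite {s}eqs in ss srt wi *.
case: k IHk IHm ss st => [|k] IHk IHm ss st.
  by move: ss; rewrite size_cat size_rcons; lia.
case/lastP: t st ct => // t' v; rewrite size_rcons => -[]; case/lastP: t' => // t u.
rewrite size_rcons => -[] st ct.
have ct' := colsP _ _ ct; have ct'' := colsP _ _ ct'.
have ss12 : size (s1 ++ s2) = k by move: ss; rewrite !size_cat size_rcons; lia.
(* Every list of rows in the three-term relation is a sublist of [x :: right]. *)
set left := x :: s1 ++ y :: s2; set right := s1 ++ y :: rcons s2 z.
have eq_left : rcons left z = x :: right by rewrite /= rcons_cat.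
have lex w : w \in right -> x < w.
  by move: w; apply/allP; apply: order_path_min srty; apply: lt_trans.
have lez w : w \in left -> w < z.
  move: srty; rewrite lt_sorted_pairwise -[_ :: _]eq_left pairwise_rcons.
  by case/andP=> /allP H _ /H.
have [lo'x zhi'] : lo' <= x /\ z <= hi'.
  move: wi; rewrite /within /= all_cat all_rcons.
  by case/and4P=> /andP[-> _] _ /andP[_ ->].
have subP r : subseq r (x :: right) -> sorted <%R r /\ within lo hi r.
  move=> sub; split; first by apply: subseq_sorted sub srty; apply: lt_trans.
  have memb w : w \in x :: right -> x <= w <= z.
    move=> wb; apply/andP; split.
      by move: wb; rewrite inE => /orP[/eqP-> // | /lex /ltW].
    by move: wb; rewrite -eq_left mem_rcons inE => /orP[/eqP-> // | /lez /ltW].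
  apply/allP=> w /(mem_subseq sub) /memb.
  by move: le_lo le_hi lo'x zhi'; clear; lia.
have sub_l : subseq left (x :: right) by rewrite -eq_left subseq_rcons.
have sub_r : subseq right (x :: right) by apply: subseq_cons.
have sub_y : subseq (s1 ++ y :: s2) (x :: right).
  by apply: subseq_trans sub_l; apply: subseq_cons.
have sub_z : subseq (s1 ++ rcons s2 z) (x :: right).
  by apply: subseq_trans sub_r; rewrite cat_subseq // subseq_cons.
have sub_x : subseq (x :: s1 ++ s2) (x :: right).
  by apply: subseq_trans sub_l; rewrite /= eqxx cat_subseq // subseq_cons.
have sub_0 : subseq (s1 ++ s2) (x :: right).
  by apply: subseq_trans sub_x; apply: subseq_cons.
have small r : size r = k.+1 -> subseq r (x :: right) ->
    pos (minor N k.+1 r (rcons t u)).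
  move=> sr /subP[srtr wr].
  apply: (IHk `|hi - lo|.+1 lo hi) => //; last by rewrite size_rcons st.
  by clear; lia.
apply: (subtraction_free_solve sf (three_term x y z u v ss12 st _)).
- by have [? ?] := subP _ sub_0; apply: nz.
- have st2 : size (rcons (rcons t u) v) = k.+2 by rewrite !size_rcons st.
  apply: posD; apply: posM.
  + have sl : size left = k.+2 by rewrite /= -ss12 !size_cat addnS.
    have wl : within lo' (hi' - 1) left.
      apply/allP=> w wl; have ltwz := lez w wl; move: wl; rewrite inE.
      case/orP=> [/eqP wx | wl].
        by rewrite wx lo'x -wx; move: ltwz zhi'; clear; lia.
      have : w \in right.
        by apply: mem_subseq wl; rewrite cat_subseq //= eqxx subseq_rcons.
      by move/lex; move: ltwz lo'x zhi'; clear; lia.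
    have [srtl _] := subP _ sub_l.
    apply: (IHm lo' (hi' - 1)) => //; move: lt_m le_hi; clear; lia.
  + by apply: small => //; rewrite -ss12 !size_cat size_rcons addnS.
  + have sr : size right = k.+2 by rewrite -ss12 !size_cat /= size_rcons !addnS.
    have wr : within (lo' + 1) hi' right.
      apply/allP=> w wr; have ltxw := lex w wr.
      have : w \in rcons left z by rewrite eq_left inE wr orbT.
      rewrite mem_rcons inE => /orP[/eqP wz|/lez].
        by move: ltxw lo'x; rewrite wz zhi'; clear; lia.
      by move: ltxw lo'x zhi'; clear; lia.
    have [srtr _] := subP _ sub_r.
    apply: (IHm (lo' + 1) hi') => //; move: lt_m le_lo; clear; lia.
  + by apply: small => //; rewrite /= ss12.
- by apply: small => //; rewrite -ss12 !size_cat /= addnS.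
- have [? ?] := subP _ sub_y.
  by apply: nz; rewrite ?size_rcons ?st // -ss12 !size_cat /= addnS.
Qed.

(** In the first use of [fill_rows] the column lists are the runs; in the second
   one, on the transposed array, they are all the increasing lists of rows. *)
Lemma fill_minors (F : fieldType) (pos : F -> Prop) (N : int -> int -> F)
    (rlo rhi clo chi : int) :
    subtraction_free pos ->
    (forall k (s t : seq int), size s = k -> size t = k ->
       sorted <%R s -> sorted <%R t -> within rlo rhi s ->
       within clo chi t -> minor N k s t != 0) ->
    (forall k a c, within rlo rhi (run a k) -> within clo chi (run c k) ->
       pos (minor N k (run a k) (run c k))) ->
  forall k (s t : seq int), size s = k -> size t = k ->
    sorted <%R s -> sorted <%R t -> within rlo rhi s -> within clo chi t -> pos (minor N k s t).
Proof.
move=> sf nz posrun.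
have posrows k s c : size s = k -> sorted <%R s -> within rlo rhi s ->
    within clo chi (run c k) -> pos (minor N k s (run c k)).
  move=> ss srt ws wc.
  pose cols t := t = run c (size t) /\ within clo chi t.
  apply: (@fill_rows _ pos N cols rlo rhi) => //.
  - move=> t v; rewrite /cols size_rcons run_rcons => -[/rcons_inj[<- _]].
    by rewrite /within all_rcons => /andP[].
  - move=> k' s' t' ss' st' srt' ws' [-> wt]; rewrite st' in wt *.
    by apply: nz; rewrite ?size_run ?sorted_run // -st'.
  - move=> k' a t' st' wa [-> wt]; rewrite st' in wt *.
    by apply: posrun; rewrite // -st'.
  - exact: size_run.
  - by rewrite /cols size_run.
move=> k s t ss st srts srtt ws wt; rewrite minor_tr.
pose cols s := sorted <%R s /\ within rlo rhi s.
apply: (@fill_rows _ pos _ cols clo chi) => //.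
- move=> s' v [srt]; rewrite /within all_rcons => /andP[_ w]; split=> //.
  by apply: subseq_sorted srt; [apply: lt_trans | apply: subseq_rcons].
- by move=> k' t' s' st' ss' srt' wt' [srts' ws']; rewrite -minor_tr; apply: nz.
- by move=> k' c s' ss' wc [srt' ws']; rewrite -minor_tr; apply: posrows.
Qed.

(** * From central minors to contiguous minors *)

Definition solid (F : comNzRingType) (N : int -> int -> F) (a c : int)
    (y : nat) : F :=
  minor N y (run a y) (run c y).

Lemma nth_run a k i : (i < k)%N -> nth 0 (run a k) i = a + i%:Z.
Proof. exact: nth_mkseq. Qed.

(** The octahedron recurrence. *)
Lemma solid_dodgson (F : fieldType) (N : int -> int -> F) a c y :
    solid N (a + 1) (c + 1) y != 0 ->
  solid N a c y.+1 * solid N (a + 1) (c + 1) y.+1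
  = solid N a c y.+2 * solid N (a + 1) (c + 1) y
    + solid N a (c + 1) y.+1 * solid N (a + 1) c y.+1.
Proof.
move=> nz; have := dodgson a (a + 1 + y%:Z) c (c + 1 + y%:Z)
  (size_run (a + 1) y) (size_run (c + 1) y) nz.
by rewrite -!run_rcons -!run_cons => ->.
Qed.

(** For [y > 0], the two extreme corners, hence all the entries, of the block with
   rows from [a] and columns from [c] lie in the strip [-n < i + j < 0]; the bound
   [2] stands for the last entry, whose indices sum to [a + c + 2 * (y - 1)]. *)
Definition in_strip (n : nat) (a c : int) (y : nat) : bool :=
  (- n%:Z < a + c) && (a + c + 2 * y%:Z < 2).

Section Central.
Variables (F : fieldType) (pos : F -> Prop) (N : int -> int -> F) (n h : nat).
Hypothesis sf : subtraction_free pos.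
Hypothesis nE : n = h.*2.+1 \/ n = h.*2.+2.
Hypothesis N_sym : forall i j, N i j = N (- j) (- i).
Hypothesis N_per : forall q i j, N (i + q * n%:Z) j = N i j.
Hypothesis solid_neq0 : forall a c y, in_strip n a c y -> solid N a c y != 0.
(* The central minors are those centred on the antidiagonals [-h] and [-h - 1],
   told apart by [e]; the usual label [x] is [2 * a + y + e]. *)
Hypothesis pos_central : forall (e : bool) a c y, (0 < y)%N -> in_strip n a c y ->
  a + c + y%:Z - 1 = - h%:Z - (e : nat)%:Z ->
  1 <= 2 * a + y%:Z + (e : nat)%:Z <= n%:Z -> pos (solid N a c y).

(** Transposition, followed by a reversal of both the rows and the columns, whose
   signs cancel. *)
Lemma solid_sym a c y : solid N a c y = solid N (1 - c - y%:Z) (1 - a - y%:Z) y.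
Proof.
case: y => [|y]; first by rewrite /solid !minor0.
rewrite /solid minor_tr /minor.
set A := (LHS in LHS = _); pose s := perm (@rev_ord_inj y.+1).
have -> : A = \det (row_perm s (col_perm s (\matrix_(i < y.+1, j < y.+1)
      N (nth 0 (run a y.+1) j) (nth 0 (run c y.+1) i)))).
  rewrite row_permE col_permE !det_mulmx !det_perm odd_permV mulrC -mulrA.
  by rewrite -expr2 sqrr_sign mulr1.
congr (\det _); apply/matrixP=> i j; rewrite !mxE !permE.
rewrite !nth_run ?ltn_ord // ?rev_ord_proof //= N_sym.
by congr (N _ _); have := ltn_ord i; have := ltn_ord j; lia.
Qed.

Lemma solid_row_shift q a c y : solid N (a + q * n%:Z) c y = solid N a c y.
Proof. by apply: eq_minor => i j lti ltj; rewrite !nth_run // addrAC N_per. Qed.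

(** The two indices move in opposite directions, so that the antidiagonal is
   kept. *)
Lemma solid_shift q a c y : solid N (a + q * n%:Z) (c - q * n%:Z) y = solid N a c y.
Proof.
rewrite solid_row_shift solid_sym -(solid_row_shift (- q)) [RHS]solid_sym.
by congr solid; lia.
Qed.

(** Transposition about the central antidiagonal of the strip. *)
Lemma solid_reflect a c y :
  solid N a c y = solid N (1 - c - y%:Z - n%:Z) (1 - a - y%:Z) y.
Proof. by rewrite solid_sym -(solid_row_shift (- 1)) mulN1r. Qed.

Lemma pos1 : pos 1. Proof. by case: sf. Qed.
Lemma posD x y : pos x -> pos y -> pos (x + y).
Proof. by case: sf => _ + _ _; apply. Qed.
Lemma posM x y : pos x -> pos y -> pos (x * y).
Proof. by case: sf => _ _ + _; apply. Qed.

(** A central minor is fixed by a translation by [n] along the antidiagonal,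
   which adds [2 * n] to its label [x]. *)
Lemma pos_central_mod (e : bool) :
    (forall a c y, (0 < y)%N -> in_strip n a c y ->
       a + c + y%:Z - 1 = - h%:Z - (e : nat)%:Z ->
       1 <= 2 * a + y%:Z + (e : nat)%:Z <= 2 * n%:Z -> pos (solid N a c y)) ->
  forall a c y, in_strip n a c y -> a + c + y%:Z - 1 = - h%:Z - (e : nat)%:Z ->
    pos (solid N a c y).
Proof.
move=> H a c [|y] st; first by rewrite /solid minor0 => _; apply: pos1.
move=> ctr; pose x := 2 * a + y.+1%:Z + (e : nat)%:Z - 1.
have n0 : 2 * n%:Z != 0 by case: nE => ->; lia.
have ltm : (x %% (2 * n%:Z))%Z < 2 * n%:Z by rewrite ltz_pmod //; lia.
have gem := modz_ge0 x n0; have := divz_eq x (2 * n%:Z).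
move: (x %/ _)%Z (x %% _)%Z gem ltm => q r gem ltm; rewrite /x => eqx.
rewrite -(solid_shift (- q)); apply: H => //.
- by move: st; rewrite /in_strip; lia.
- by rewrite -ctr; lia.
- by lia.
Qed.

(** The central minors that reflection maps to central minors with [x] lowered
   by [n]: all of them when [n] is odd, those with [x + y] odd when [n] is
   even. *)
Lemma pos_central_reflect (e : bool) a c y : odd n || e ->
    in_strip n a c y -> a + c + y%:Z - 1 = - h%:Z - (e : nat)%:Z ->
  pos (solid N a c y).
Proof.
move=> odd_ne; apply: (@pos_central_mod e) => {}a {}c {}y y0 st ctr rg.
have [le_n | gt_n] := lerP (2 * a + y%:Z + (e : nat)%:Z) n%:Z.
  by apply: (pos_central (e := e)) => //; move: rg le_n; clear; lia.
rewrite solid_reflect; apply: (pos_central (e := odd n (+) e)) => //.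
- by move: st; rewrite /in_strip; lia.
- by case: nE odd_ne ctr => -> /=; rewrite odd_double; case: e {rg gt_n} => //=; lia.
- by case: nE odd_ne ctr gt_n rg => -> /=; rewrite odd_double; case: e => //=; lia.
Qed.

(** When [n] is even, condensation centred on the axis of the reflection
   expresses the product of the two central minors labelled [x] and [x + n],
   of which only one has a label between [1] and [n]. *)
Lemma pos_central_even a c y : ~~ odd n ->
    in_strip n a c y -> a + c + y%:Z - 1 = - h%:Z ->
  pos (solid N a c y).
Proof.
move=> ev st ctr; apply: (@pos_central_mod false) => //; last by rewrite subr0.
move=> {st ctr}a {}c [//|{}y] _ st; rewrite subr0 addr0 => ctr rg.
have eqn : n = h.*2.+2 by case: nE ev => -> //=; rewrite odd_double.
have [le_n | gt_n] := lerP (2 * a + y.+1%:Z) n%:Z.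
  by apply: (pos_central (e := false)) => //; rewrite ?subr0 ?addr0 //; lia.
have inS a' c' y' : in_strip n a' c' y' -> a' + c' + y'%:Z - 1 = - h%:Z - 1 ->
    pos (solid N a' c' y') by apply: (@pos_central_reflect true); rewrite orbT.
have nz : solid N (a - 1 + 1) (c - 1 + 1) y != 0.
  by apply: solid_neq0; move: st; rewrite /in_strip; lia.
have := solid_dodgson nz; rewrite !subrK mulrC => dg.
apply: (subtraction_free_solve sf dg).
- by apply: posD; apply: posM; apply: inS; move: st; rewrite /in_strip; lia.
- rewrite solid_reflect; apply: (pos_central (e := false)) => //;
    move: st; rewrite /in_strip; lia.
- by apply: solid_neq0; move: st; rewrite /in_strip; lia.
Qed.

Lemma pos_central_all (e : bool) a c y :
    in_strip n a c y -> a + c + y%:Z - 1 = - h%:Z - (e : nat)%:Z ->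
  pos (solid N a c y).
Proof.
have [odd_ne | ] := boolP (odd n || e); first exact: pos_central_reflect.
by rewrite negb_or => /andP[ev /negbTE->]; rewrite subr0; apply: pos_central_even.
Qed.

(** Condensation, read as an octahedron recurrence, determines the contiguous
   minors centred on an antidiagonal by those centred on the two previous
   ones; reflection exchanges the two halves of the strip. *)
Lemma pos_solid a c y : in_strip n a c y -> pos (solid N a c y).
Proof.
suff half m a' c' y' : in_strip n a' c' y' ->
    a' + c' + y'%:Z - 1 = m%:Z - h%:Z - 1 -> pos (solid N a' c' y').
  move=> st; have [ge | lt] := lerP (- h%:Z - 1) (a + c + y%:Z - 1).
    by apply: (half (absz (a + c + y%:Z + h%:Z)%R)) => //; lia.
  rewrite solid_reflect; apply: (half (absz (h%:Z + 1 - a - c - y%:Z - n%:Z + 1)%R)).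
    by move: st; rewrite /in_strip; lia.
  by lia.
suff: (forall a c y, in_strip n a c y -> a + c + y%:Z - 1 = m%:Z - h%:Z - 1 ->
         pos (solid N a c y)) /\
      (forall a c y, in_strip n a c y -> a + c + y%:Z - 1 = m.+1%:Z - h%:Z - 1 ->
         pos (solid N a c y)) by case=> H _; apply: H.
elim: m => [|m [IH0 IH1]].
  split=> {}a {}c {}y st ctr.
    by apply: (@pos_central_all true) => //; lia.
  by apply: (@pos_central_all false) => //; lia.
split=> // {}a {}c [|{}y] st ctr; first by rewrite /solid minor0; apply: pos1.
have nz : solid N (a - 1 + 1) (c - 1 + 1) y != 0.
  by apply: solid_neq0; move: st; rewrite /in_strip; lia.
have := solid_dodgson nz; rewrite !subrK mulrC => dg.
apply: (subtraction_free_solve sf dg).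
- by apply: posD; apply: posM; apply: IH1; move: st; rewrite /in_strip; lia.
- by apply: IH0; move: st; rewrite /in_strip; lia.
- by apply: solid_neq0; move: st; rewrite /in_strip; lia.
Qed.

End Central.

(** * All minors in a strip *)

Section Strip.
Variables (F : fieldType) (pos : F -> Prop) (N : int -> int -> F) (n h : nat).

Definition strip_lists (s t : seq int) : Prop :=
  forall x y, x \in s -> y \in t -> - n%:Z < x + y < 0.

Hypothesis sf : subtraction_free pos.
Hypothesis nE : n = h.*2.+1 \/ n = h.*2.+2.
Hypothesis N_sym : forall i j, N i j = N (- j) (- i).
Hypothesis N_per : forall q i j, N (i + q * n%:Z) j = N i j.
Hypothesis minor_neq0 : forall k (s t : seq int), size s = k -> size t = k ->
  sorted <%R s -> sorted <%R t -> strip_lists s t -> minor N k s t != 0.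
Hypothesis pos_central : forall (e : bool) a c y, (0 < y)%N -> in_strip n a c y ->
  a + c + y%:Z - 1 = - h%:Z - (e : nat)%:Z ->
  1 <= 2 * a + y%:Z + (e : nat)%:Z <= n%:Z -> pos (solid N a c y).

Lemma within_head_last (x : int) s :
  sorted <%R (x :: s) -> within x (last x s) (x :: s).
Proof.
move=> srt; apply/allP=> y yin; apply/andP; split.
  move: yin; rewrite inE => /orP[/eqP-> //|]; move: y; apply/allP.
  by apply: sub_all (order_path_min lt_trans srt) => y; apply: ltW.
move: srt yin; rewrite lastI lt_sorted_pairwise pairwise_rcons mem_rcons inE.
by case/andP=> /allP H _ /orP[/eqP-> // | /H /ltW].
Qed.

(** The rectangle spanned by the first and last rows and columns has two corners
   in the strip that bound the sums [i + j] over it, so it lies in the strip. *)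
Lemma pos_strip k (s t : seq int) : size s = k -> size t = k ->
  sorted <%R s -> sorted <%R t -> strip_lists s t -> pos (minor N k s t).
Proof.
case: k => [|k]; first by rewrite minor0 => *; case: sf.
case: s t => [|x s] [|y t] // ss st srts srtt strip.
have lo : - n%:Z < x + y by have /andP[] := strip x y (mem_head _ _) (mem_head _ _).
have hi : last x s + last y t < 0.
  by have /andP[] := strip _ _ (mem_last x s) (mem_last y t).
have inD k' s' t' : within x (last x s) s' -> within y (last y t) t' ->
    size s' = k' -> strip_lists s' t'.
  move=> /allP ws /allP wt _ u v /ws + /wt; move: lo hi; clear; lia.
apply: (@fill_minors _ pos N x (last x s) y (last y t)) => //; last 2 first.
- exact: within_head_last.
- exact: within_head_last.
- by move=> k' s' t' *; apply: minor_neq0 => //; apply: (inD k').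
move=> [|k'] a c wa wc; first by rewrite minor0; case: sf.
apply: (@pos_solid _ pos N n h) => //.
- move=> a' c' y' st'; apply: minor_neq0; rewrite ?size_run ?sorted_run //.
  by move=> u v; rewrite !mem_run; move: st'; rewrite /in_strip; lia.
have H := inD k'.+1 _ _ wa wc (size_run _ _).
have {}H i j : (i < k'.+1)%N -> (j < k'.+1)%N -> - n%:Z < (a + i%:Z) + (c + j%:Z) < 0.
  by move=> lti ltj; apply: H; rewrite mem_run; lia.
have := H 0%N 0%N isT isT; have := H k' k' (ltnSn _) (ltnSn _).
by rewrite /in_strip; lia.
Qed.
End Strip.

(** * Positive rational functions *)

Lemma nonneg_coefsD (R : realDomainType) N (p q : {mpoly R[N]}) :
  nonneg_coefs p -> nonneg_coefs q -> nonneg_coefs (p + q).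
Proof. by move=> p0 q0 m; rewrite mcoeffD addr_ge0. Qed.

Lemma nonneg_coefsM (R : realDomainType) N (p q : {mpoly R[N]}) :
  nonneg_coefs p -> nonneg_coefs q -> nonneg_coefs (p * q).
Proof. by move=> p0 q0 m; rewrite mcoeffM sumr_ge0 // => i _; rewrite mulr_ge0. Qed.

Lemma nonneg_coefs1 (R : realDomainType) N : nonneg_coefs (1 : {mpoly R[N]}).
Proof. by move=> m; rewrite mcoeff1 ler0n. Qed.

(** Nonnegative coefficients cannot cancel. *)
Lemma nonneg_coefsD_neq0 (R : realDomainType) N (p q : {mpoly R[N]}) :
  p != 0 -> nonneg_coefs p -> nonneg_coefs q -> p + q != 0.
Proof.
move=> pn0 p0 q0; apply: contra pn0 => /eqP pq; apply/eqP/mpolyP=> m.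
have /eqP := congr1 (mcoeff m) pq.
by rewrite mcoeffD mcoeff0 paddr_eq0 // => /andP[/eqP].
Qed.

Lemma quotients_subtraction_free (A : comNzRingType) (F : fieldType)
    (ev : {rmorphism A -> F}) (good : A -> Prop) :
    good 1 -> (forall p q, good p -> good q -> good (p + q)) ->
    (forall p q, good p -> good q -> good (p * q)) ->
  subtraction_free (fun f => exists P Q,
    [/\ good P, good Q, ev Q != 0 & f = ev P / ev Q]).
Proof.
move=> good1 goodD goodM; split.
- by exists 1, 1; split=> //; rewrite rmorph1 ?divr1 ?oner_neq0.
- move=> _ _ [P [Q [gP gQ nQ ->]]] [P' [Q' [gP' gQ' nQ' ->]]].
  exists (P * Q' + P' * Q), (Q * Q'); rewrite rmorphD !rmorphM addf_div //.
  by split; [apply: goodD; apply: goodM | apply: goodM | apply: mulf_neq0 | ].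
- move=> _ _ [P [Q [gP gQ nQ ->]]] [P' [Q' [gP' gQ' nQ' ->]]].
  exists (P * P'), (Q * Q'); rewrite !rmorphM mulf_div.
  by split; [apply: goodM | apply: goodM | apply: mulf_neq0 | ].
- move=> _ _ [P [Q [gP gQ nQ ->]]] [P' [Q' [gP' gQ' nQ' ->]]].
  rewrite mulf_eq0 invr_eq0 negb_or => /andP[nP' _].
  exists (P * Q'), (Q * P'); rewrite !rmorphM invf_div mulf_div.
  by split; [apply: goodM | apply: goodM | apply: mulf_neq0 | ].
Qed.

Lemma positive_ratfun_sf (R : realDomainType) N l (u : N.-tuple {mpoly R[l]}) :
  subtraction_free (positive_ratfun_of u).
Proof.
pose good (p : {mpoly R[N]}) := p != 0 /\ nonneg_coefs p.
have goodD p q : good p -> good q -> good (p + q).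
  by move=> [pn p0] [_ q0]; split; [apply: nonneg_coefsD_neq0 | apply: nonneg_coefsD].
have goodM p q : good p -> good q -> good (p * q).
  by move=> [pn p0] [qn q0]; split; [apply: mulf_neq0 | apply: nonneg_coefsM].
have good1 : good 1 by split; [apply: oner_neq0 | apply: nonneg_coefs1].
have posE f : positive_ratfun_of u f <-> exists P Q, [/\ good P, good Q,
    (@tofrac _ \o comp_mpoly u) Q != 0
    & f = (@tofrac _ \o comp_mpoly u) P / (@tofrac _ \o comp_mpoly u) Q].
  by split=> -[P [Q H]]; exists P, Q; move: H; rewrite /= tofrac_eq0.
have [p1 pD pM pV] := @quotients_subtraction_free _ _
  (@tofrac _ \o comp_mpoly u) _ good1 goodD goodM.
split=> [|f g|f g|f g]; rewrite !posE; [exact: p1 | exact: pD | exact: pM | exact: pV].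
Qed.

Lemma positive_ratfun_tnth (R : realDomainType) N l (u : N.-tuple {mpoly R[l]}) i :
  positive_ratfun_of u (tofrac (tnth u i)).
Proof.
exists 'X_i, 1; rewrite comp_mpolyXU comp_mpoly1 tofrac1 divr1 -tnth_nth !oner_neq0.
do ?split=> //; last exact: nonneg_coefs1.
- apply/negP=> /eqP/(congr1 (mcoeff U_(i)%MM))/eqP.
  by rewrite mcoeffX eqxx mcoeff0 oner_eq0.
- by move=> m; rewrite mcoeffX ler0n.
Qed.

(** * The generic symmetric matrix *)

Lemma cyc_idx_shift n (n_gt0 : (0 < n)%N) q z :
  cyc_idx n_gt0 (z + q * n%:Z) = cyc_idx n_gt0 z.
Proof. by apply: val_inj; rewrite /= addrC modzMDl. Qed.

Lemma cyc_idx_ord n (n_gt0 : (0 < n)%N) (i : 'I_n) : cyc_idx n_gt0 i%:Z = i.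
Proof. by apply: val_inj; rewrite /= modz_small //= ltz_nat ltn_ord. Qed.

Lemma cyc_idx_inj n (n_gt0 : (0 < n)%N) x y :
  - n%:Z < x - y < n%:Z -> cyc_idx n_gt0 x = cyc_idx n_gt0 y -> x = y.
Proof.
move=> lt_xy /(congr1 val) /= eqm.
have n0 : n%:Z != 0 by lia.
have : (x %% n%:Z)%Z = (y %% n%:Z)%Z.
  by rewrite -[LHS]gez0_abs ?modz_ge0 // eqm gez0_abs ?modz_ge0.
move/eqP; rewrite eqz_mod_dvd => /dvdzP[q eq_q].
have q0 : q = 0 by nia.
by apply/eqP; rewrite -subr_eq0 eq_q q0 mul0r.
Qed.

(** Changing the sign of the column index makes both index lists of a
   noninterlaced minor increasing, and turns the diagonals [b - a = const] into antidiagonals. *)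
Definition unrolled (R : comNzRingType) n (n_gt0 : (0 < n)%N) (M : 'M[R]_n)
  (i j : int) : R := M (cyc_idx n_gt0 i) (cyc_idx n_gt0 (- j)).

Lemma contiguous_minorE (R : comNzRingType) n (n_gt0 : (0 < n)%N) (M : 'M[R]_n) a b y :
  contiguous_minor n_gt0 M a b y = solid (unrolled n_gt0 M) a (1 - b - y%:Z) y.
Proof.
congr (\det _); apply/matrixP=> i j; rewrite !mxE !nth_run // /unrolled.
by congr (M _ (cyc_idx _ _)); lia.
Qed.

Lemma map_minor (R S : comNzRingType) (f : {rmorphism R -> S}) N k s t :
  f (minor N k s t) = minor (fun i j => f (N i j)) k s t.
Proof.
by rewrite /minor -det_map_mx; congr (\det _); apply/matrixP=> i j; rewrite !mxE.
Qed.

(** Setting the diagonal indeterminates to one and all others to zero yields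
   the identity matrix. *)
Lemma det_indeterminates_neq0 (R : comNzRingType) K k (f : 'I_k -> 'I_k -> 'I_K) :
    (forall i j m, f i j = f m m -> i = j) ->
  \det (\matrix_(i, j) 'X_(f i j) : 'M[{mpoly R[K]}]_k) != 0.
Proof.
move=> inj; pose v x : R := [exists m, f m m == x]%:R.
apply/negP=> /eqP/(congr1 (meval v))/eqP.
rewrite -det_map_mx meval0 (_ : map_mx _ _ = 1%:M) ?det1 ?oner_eq0 //.
apply/matrixP=> i j; rewrite !mxE [LHS]mevalXU /v; congr (_ %:R); congr nat_of_bool.
apply/existsP/eqP => [[m /eqP/esym/inj] // | ->].
by exists j.
Qed.

Lemma sym_pair_eq n (i j i' j' : 'I_n) : sym_pair i j = sym_pair i' j' ->
  (i = i' /\ j = j') \/ (i = j' /\ j = i').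
Proof.
move/(congr1 val); rewrite /= /sort_pair.
by case: ifP => _; case: ifP => _ [-> ->]; auto.
Qed.

(** In a strip the row classes and the column classes are disjoint, so no
   indeterminate of a minor occurs in two of its entries. *)
Lemma generic_minor_neq0 (R : comNzRingType) n (n_gt0 : (0 < n)%N) k (s t : seq int) :
    size s = k -> size t = k -> sorted <%R s -> sorted <%R t -> strip_lists n s t ->
  minor (unrolled n_gt0 (generic_sym R n)) k s t != 0.
Proof.
move=> ss st srts srtt strip.
pose row (i : 'I_k) := cyc_idx n_gt0 (nth 0 s i).
pose col (j : 'I_k) := cyc_idx n_gt0 (- nth 0 t j).
have stripE (i j : 'I_k) : - n%:Z < nth 0 s i + nth 0 t j < 0.
  by apply: strip; apply: mem_nth; rewrite ?ss ?st.
have uniqE (w : seq int) (i j : 'I_k) : size w = k -> sorted <%R w ->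
    nth 0 w i = nth 0 w j -> i = j.
  move=> sw srt /eqP; rewrite nth_uniq ?sw ?ltn_ord ?lt_sorted_uniq // => /eqP.
  exact: val_inj.
rewrite (_ : minor _ _ _ _
    = \det (\matrix_(i, j) 'X_(enum_rank (sym_pair (row i) (col j))))); last first.
  by congr (\det _); apply/matrixP=> i j; rewrite !mxE /unrolled mxE.
apply: det_indeterminates_neq0 => i j m /enum_rank_inj/sym_pair_eq.
case=> [[eqr eqc] | [eqrc _]].
  have /uniqE -> // : nth 0 s i = nth 0 s m.
    by apply: cyc_idx_inj eqr; have := stripE i m; have := stripE m m; lia.
  apply: esym; apply: (uniqE t) => //; apply: oppr_inj.
  by apply: cyc_idx_inj eqc; have := stripE m j; have := stripE m m; lia.
have := stripE i m; suff : nth 0 s i = - nth 0 t m by lia.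
by apply: cyc_idx_inj eqrc; have := stripE i m; lia.
Qed.

(** The lift keeps the part of [s] that comes before the cut [0] of the circle and
   adds one turn to the part that comes after it. *)
Lemma unroll_cyclic n (n_gt0 : (0 < n)%N) (s : seq 'I_n) : in_cyclic_order s ->
  exists L : seq int, [/\ map (cyc_idx n_gt0) L = s, sorted <%R L
    & forall x y, x \in L -> y \in L -> y - x < n%:Z].
Proof.
case=> r; rewrite /rot => srt.
have {srt} : pairwise (fun i j : 'I_n => (i < j)%N) (drop r s ++ take r s).
  by rewrite -sorted_pairwise // => y x z; apply: ltn_trans.
rewrite pairwise_cat => /and3P[/allrelP dt pd pt].
pose L1 := [seq (i : nat)%:Z | i : 'I_n <- take r s].
pose L2 := [seq (i : nat)%:Z + n%:Z | i : 'I_n <- drop r s].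
exists (L1 ++ L2); split.
- rewrite map_cat -[RHS](cat_take_drop r); congr (_ ++ _);
    rewrite -map_comp -[RHS]map_id;
    apply: eq_map => i /=; last rewrite -[n%:Z]mul1r cyc_idx_shift; exact: cyc_idx_ord.
- rewrite lt_sorted_pairwise pairwise_cat !pairwise_map; apply/and3P; split.
  + apply/allrelP=> x y /mapP[i _ ->] /mapP[j _ ->].
    by have := ltn_ord i; clear; lia.
  + by apply: sub_pairwise pt => i j /=; rewrite ltz_nat.
  + by apply: sub_pairwise pd => i j /=; rewrite ltrD2r ltz_nat.
- move=> x y; rewrite !mem_cat => /orP[]/mapP[i iin ->] /orP[]/mapP[j jin ->];
    have := ltn_ord i; have := ltn_ord j; rewrite /=; try by clear; lia.
  by have := dt _ _ jin iin; clear; lia.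
Qed.

Section GenericArray.
Variables (R : realDomainType) (n : nat) (n_gt0 : (0 < n)%N).
Let entries := unrolled n_gt0 (generic_sym R n).
Let array i j : {fraction {mpoly R[#|sym_idx n|]}} := tofrac (entries i j).

Lemma array_sym i j : array i j = array (- j) (- i).
Proof. by rewrite /array /entries /unrolled opprK -[in LHS]tr_generic_sym mxE. Qed.

Lemma array_per q i j : array (i + q * n%:Z) j = array i j.
Proof. by rewrite /array /entries /unrolled cyc_idx_shift. Qed.

Lemma minor_array k s t : minor array k s t = tofrac (minor entries k s t).
Proof. by rewrite (map_minor (@tofrac _)). Qed.

(** For both parities of [n] the floors in the definition of a central minor give
   [b - a = h + e], which is the equation of an antidiagonal since
   [c = 1 - b - y].  When [y = n / 2], the strip leaves room only for the
   antidiagonal [-n / 2], that is for [x + y] odd. *)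
Lemma pos_small_central h (e : bool) a c y : n = h.*2.+1 \/ n = h.*2.+2 ->
    (0 < y)%N -> in_strip n a c y -> a + c + y%:Z - 1 = - h%:Z - (e : nat)%:Z ->
    1 <= 2 * a + y%:Z + (e : nat)%:Z <= n%:Z ->
  positive_ratfun_of (small_central_minors n_gt0 (generic_sym R n)) (solid array a c y).
Proof.
move=> nE y0 st ctr rg.
pose x := absz (2 * a + y%:Z + (e : nat)%:Z)%R.
have xE : x%:Z = 2 * a + y%:Z + (e : nat)%:Z by rewrite /x gez0_abs //; lia.
have ltx : (x < n.+1)%N by lia.
have lty : (y < n.+1)%N by move: st; rewrite /in_strip; lia.
pose p : 'I_n.+1 * 'I_n.+1 := (Ordinal ltx, Ordinal lty).
have small : (0 < p.1)%N && (0 < p.2)%N &&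
    ((p.2 * 2 < n)%N || ((p.2 * 2 == n)%N && odd (p.1 + p.2))).
  rewrite /= y0 andbT; apply/andP; split; first by lia.
  have [//|ge] := ltnP (y * 2) n.
  have eqy : (y * 2)%N = n.
    by move: st; rewrite /in_strip; case: nE ge => ->; lia.
  have e1 : (e : nat) = 1%N.
    move: st eqy ctr; rewrite /in_strip.
    by case: nE => ->; case: (e) => /=; lia.
  by rewrite eqy eqxx /=; move: xE; rewrite e1; clear; lia.
have := positive_ratfun_tnth (small_central_minors n_gt0 (generic_sym R n))
  (enum_rank (exist _ p small : small_idx n)).
rewrite tnth_mktuple enum_rankK /= /central_minor contiguous_minorE.
have -> : ((x%:Z - y%:Z) %/ 2)%Z = a by rewrite xE; case: (e); lia.
have -> : ((x%:Z - y%:Z + n%:Z - ((n.-1 %% 2)%N)%:Z) %/ 2)%Z = 1 - c - y%:Z.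
  by rewrite xE; move: ctr; clear -nE; case: nE => ->; case: (e) => /=; lia.
have -> : 1 - (1 - c - y%:Z) - y%:Z = c by clear; lia.
by rewrite [in X in _ -> X]/solid minor_array.
Qed.

Lemma pos_strip_generic k (s t : seq int) : size s = k -> size t = k ->
    sorted <%R s -> sorted <%R t -> strip_lists n s t ->
  positive_ratfun_of (small_central_minors n_gt0 (generic_sym R n))
    (tofrac (minor entries k s t)).
Proof.
move=> ss st srts srtt strip; rewrite -minor_array.
have nE : n = n.-1./2.*2.+1 \/ n = n.-1./2.*2.+2.
  by have := odd_double_half n.-1; case: (odd _) => /= e; [right | left]; lia.
apply: (pos_strip (positive_ratfun_sf _) nE array_sym array_per) => //.
- move=> k' s' t' *; rewrite minor_array tofrac_eq0; exact: generic_minor_neq0.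
- by move=> e a c y *; apply: (@pos_small_central n.-1./2 e).
Qed.

End GenericArray.

Theorem theorem4p6 (R : realDomainType) (n : nat) (n_gt0 : (0 < n)%N)
    (k : nat) (A B : {set 'I_n}) (a b : k.-tuple 'I_n)
    (noninterlacedAB : noninterlaced n_gt0 A B)
    (cardA : #|A| = k) (cardB : #|B| = k)
    (enumA : A = [set i in a]) (enumB : B = [set i in b])
    (cyclic_ab : in_cyclic_order (a ++ rev b)) :
  positive_ratfun_of
    (small_central_minors n_gt0 (generic_sym R n))
    (tofrac (\det (mxsub (tnth a) (tnth b) (generic_sym R n)))).
Proof.
have [L [mapL srtL shortL]] := unroll_cyclic n_gt0 cyclic_ab.
have sL : size L = (k + k)%N.
  by rewrite -(size_map (cyc_idx n_gt0)) mapL size_cat size_rev !size_tuple.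
pose s := take k L; pose u := drop k L; pose t := [seq - z | z <- rev u].
have ss : size s = k by rewrite size_take_min sL; lia.
have su : size u = k by rewrite size_drop sL addKn.
have st : size t = k by rewrite size_map size_rev.
have [mapa mapb] : map (cyc_idx n_gt0) s = a /\ map (cyc_idx n_gt0) u = rev b.
  by rewrite map_take map_drop mapL take_size_cat ?drop_size_cat ?size_tuple.
have /and3P[/allrelP lt_su srts srtu] :
    [&& allrel <%R s u, pairwise <%R s & pairwise <%R u].
  by move: srtL; rewrite -[L](cat_take_drop k) lt_sorted_pairwise pairwise_cat.
have srtt : sorted <%R t.
  rewrite sorted_map rev_sorted -lt_sorted_pairwise in srtu *.
  by apply: sub_sorted srtu => x y /=; rewrite ltrN2.
have strip : strip_lists n s t.
  move=> x _ xs /mapP[y + ->]; rewrite mem_rev => yu.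
  have := lt_su _ _ xs yu; have := shortL x y (mem_take xs) (mem_drop yu).
  by lia.
have -> : \det (mxsub (tnth a) (tnth b) (generic_sym R n))
    = minor (unrolled n_gt0 (generic_sym R n)) k s t.
  have aE i : tnth a i = cyc_idx n_gt0 (nth 0 s i).
    by rewrite (tnth_nth (cyc_idx n_gt0 0)) -mapa (nth_map 0) ?ss.
  have bE j : tnth b j = cyc_idx n_gt0 (- nth 0 t j).
    rewrite (tnth_nth (cyc_idx n_gt0 0)) -[tval b]revK -mapb -map_rev.
    by rewrite !(nth_map 0) ?opprK ?size_rev ?su.
  by congr (\det _); apply/matrixP=> i j; rewrite !mxE aE bE /unrolled mxE.
by apply: pos_strip_generic => //; rewrite lt_sorted_pairwise.
Qed.
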